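(* Let $\mathcal{F}=\{f(\cdot;\theta):\theta\in\Theta\}\subset\mathrm{cvx}(\mathcal{X})$, $\Theta\subset\mathbb{R}^M$, and let $\mu,\nu$ be probability distributions. Suppose assumptions (i)–(iii) of the context hold. Let $\bar\theta\in\mathrm{argmin}_{\theta\in\Theta}\tilde J_{\mu,\nu}(\theta)$ belong to the interior of $\Theta$, and let $T_{\mathcal{F}}(y;\bar\theta):=\nabla_y f^\star(y;\bar\theta)$. Then $$\int g(x)\,d\mu(x)=\int g\big(T_{\mathcal{F}}(y;\bar\theta)\big)\,d\nu(y)\qquad\text{for all } g\in\mathrm{Tan}_{\bar\theta}\mathcal{F}.$$
   Context: $\mathcal{X}\subseteq\mathbb{R}^d$ is the underlying space and $\mathrm{cvx}(\mathcal{X})$ is the set of lower semicontinuous proper convex functions on $\mathcal{X}$. The convex conjugate with respect to the first input is $f^\star(y;\theta)=\sup_{x}[\langle x,y\rangle-f(x;\theta)]$, the supremum being over the space on which $f(\cdot;\theta)$ is defined, and $$\tilde J_{\mu,\nu}(\theta)=\int f(x;\theta)\,d\mu(x)+\int f^\star(y;\theta)\,d\nu(y).$$ Tangent space: $\mathrm{Tan}_\theta\mathcal{F}:=\mathrm{span}\{\frac{\partial f}{\partial\theta_m}(\cdot;\theta):m=1,\dots,M\}$. Assumptions: (i) $\mu$ and $\nu$ are supported on compact sets in $\mathbb{R}^d$. (ii) $f(x;\theta)$ is differentiable with respect to $\theta$ for all $x\in\mathcal{X}$, and $\nabla_\theta f(x;\theta)$ is continuous with respect to $x$. (iii) For every $\theta\in\Theta$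 there exist $L(\theta)>0$ and a neighbourhood $U$ of $\theta$ such that $\|\nabla_\theta f(x;\theta')\|_2<L(\theta)$ for all $x\in\mathcal{X}$ and $\theta'\in U$.
   Formalization: Continuity of the θ-gradient in x is required locally uniformly in θ (plain continuity in x makes the claim false), the minimum of J must be finite, and the gradient T of the conjugate is assumed to exist with values in X for ν-almost every y. *)

(* Defs.v *)
From HB Require Import structures.
From mathcomp Require Import all_boot all_order all_algebra.
From mathcomp Require Import all_classical all_reals all_analysis.

Set Implicit Arguments.
Unset Strict Implicit.
Unset Printing Implicit Defensive.

Import Order.TTheory GRing.Theory Num.Theory.
Import numFieldNormedType.Exports.

Local Open Scope classical_set_scope.
Local Open Scope ring_scope.

Notation borel R d := (g_sigma_algebraType (@open 'rV[R]_d)).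

(* The library norm on 'rV[R]_n is the sup norm. *)
Definition norm2 (R : realType) (n : nat) (u : 'rV[R]_n) : R :=
  Num.sqrt (\sum_i u 0 i ^+ 2).

Definition inner (R : realType) (n : nat) (u v : 'rV[R]_n) : R :=
  \sum_i u 0 i * v 0 i.

Definition compactly_supported (R : realType) (d : nat)
    (mu : probability (borel R d) R) : Prop :=
  exists2 K : set 'rV[R]_d, compact K & mu (~` K) = 0%E.

Definition ediff (R : realType) (n : nat) (F : 'rV[R]_n -> \bar R)
    (a : 'rV[R]_n) : Prop :=
  (\forall b \near a, F b \is a fin_num) /\
  differentiable (fine \o F : 'rV[R]_n -> R^o) a.

(* Meaningful only where [ediff F a] holds. *)
Definition egrad (R : realType) (n : nat) (F : 'rV[R]_n -> \bar R)
    (a : 'rV[R]_n) : 'rV[R]_n :=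
  \row_i 'D_(delta_mx 0 i) (fine \o F : 'rV[R]_n -> R^o) a.

(* Functions on X are represented by functions on the whole space whose values
   outside X are irrelevant; lower semicontinuity is relative to X. *)
Definition cvx (R : realType) (d : nat) (X : set 'rV[R]_d) :
    set ('rV[R]_d -> \bar R) :=
  [set h : 'rV[R]_d -> \bar R | [/\ convex_set X,
      (forall x y (t : R), X x -> X y -> 0 <= t <= 1 ->
        (h (t *: x + (1 - t) *: y)%R <= t%:E * h x + (1 - t)%:E * h y)%E),
      (forall x, X x -> (-oo < h x)%E),
      (exists2 x, X x & (h x < +oo)%E) &
      lower_semicontinuous (h : subspace X -> \bar R)]].

Definition conjugate (R : realType) (d : nat) (X : set 'rV[R]_d)
    (h : 'rV[R]_d -> \bar R) (y : 'rV[R]_d) : \bar R :=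
  ereal_sup [set ((inner x y)%:E - h x)%E | x in X].

Definition Jtilde (R : realType) (d M : nat) (X : set 'rV[R]_d)
    (f : 'rV[R]_d -> 'rV[R]_M -> \bar R)
    (mu nu : probability (borel R d) R) (t : 'rV[R]_M) : \bar R :=
  (\int[mu]_(x in X) f x t + \int[nu]_y conjugate X (f^~ t) y)%E.

(* As usual in variational analysis, a functional that is identically +oo has
   no minimizer. *)
Definition argmin (R : realType) (T : Type) (A : set T) (J : T -> \bar R) :
    set T :=
  [set a | [/\ A a, (J a < +oo)%E & forall b, A b -> (J a <= J b)%E]].

Definition theta_differentiable (R : realType) (d M : nat)
    (X : set 'rV[R]_d) (Theta : set 'rV[R]_M)
    (f : 'rV[R]_d -> 'rV[R]_M -> \bar R) : Prop :=
  forall x t, X x -> Theta° t -> ediff (f x) t.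

(* Continuity of the theta-gradient in x, locally uniformly in theta.  Taking
   t = t0 gives continuity of x |-> egrad (f x) t0 on X; joint continuity of
   (x, t) |-> egrad (f x) t implies the condition.  Continuity in x for each
   theta separately does not suffice for the first-order condition: a bump of
   height of order |t| and width of order sqrt |t| in x can then move the
   maximizers of the conjugate. *)
Definition theta_gradient_continuous (R : realType) (d M : nat)
    (X : set 'rV[R]_d) (Theta : set 'rV[R]_M)
    (f : 'rV[R]_d -> 'rV[R]_M -> \bar R) : Prop :=
  forall x0 t0, X x0 -> Theta° t0 -> forall e : R, 0 < e ->
    \forall x \near x0 & t \near t0, X x -> Theta° t ->
      norm2 (egrad (f x) t - egrad (f x0) t) < e.

Definition theta_gradient_bounded (R : realType) (d M : nat)
    (X : set 'rV[R]_d) (Theta : set 'rV[R]_M)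
    (f : 'rV[R]_d -> 'rV[R]_M -> \bar R) : Prop :=
  forall t, Theta t -> exists2 L : R, 0 < L &
    \forall t' \near t, Theta° t' ->
      forall x, X x -> norm2 (egrad (f x) t') < L.

Definition Tan (R : realType) (d M : nat) (X : set 'rV[R]_d)
    (f : 'rV[R]_d -> 'rV[R]_M -> \bar R) (t : 'rV[R]_M) :
    set ('rV[R]_d -> R) :=
  [set g | exists c : 'I_M -> R, forall x, X x ->
    g x = \sum_m c m * egrad (f x) t 0 m].

Definition transport (R : realType) (d M : nat) (X : set 'rV[R]_d)
    (f : 'rV[R]_d -> 'rV[R]_M -> \bar R) (t : 'rV[R]_M) :
    'rV[R]_d -> 'rV[R]_d :=
  egrad (conjugate X (f^~ t)).

(* The map y |-> transport X f t y is defined nu-almost everywhere, as a map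
   into X, where the functions of Tan X f t live. *)
Definition transport_defined (R : realType) (d M : nat) (X : set 'rV[R]_d)
    (f : 'rV[R]_d -> 'rV[R]_M -> \bar R) (nu : probability (borel R d) R)
    (t : 'rV[R]_M) : Prop :=
  {ae nu, forall y, ediff (conjugate X (f^~ t)) y /\ X (transport X f t y)}.

(* Main.v *)
(* Move theta along a line [tbar + s *: v].  The conjugate at a point [y] where
   it is differentiable has, in [s], the derivative of [- f (T y)]: every
   near-maximizer of [<x, y> - f x tbar] is close to [T y], and there the
   increments of [f] in theta agree with those at [T y] up to [o(s)].  The
   difference quotients are bounded, so by dominated convergence the functional
   has a one-sided derivative along [v], nonnegative at a minimizer.  Taking [v]
   and [- v] gives equality. *)
Require Import Defs.
From HB Require Import structures.
From mathcomp Require Import all_boot all_order all_algebra.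
From mathcomp Require Import all_classical all_reals all_analysis.
From mathcomp Require Import measurable_realfun ring lra.

Import Order.TTheory GRing.Theory Num.Theory.
Import numFieldNormedType.Exports.

Local Open Scope classical_set_scope.
Local Open Scope ring_scope.

Set Implicit Arguments.
Unset Strict Implicit.

Import HBNNSimple.

(** * Integration: null sets, integrability, difference quotients *)

(* No measurability of [h]: a transport map may be arbitrary on a null set. *)
Lemma integral_setDnull (disp : measure_display) (T : measurableType disp)
    (R : realType) (mu : {measure set T -> \bar R}) (D N : set T)
    (h : T -> \bar R) :
  measurable N -> mu N = 0%E ->
  (\int[mu]_(x in D) h x = \int[mu]_(x in D `\` N) h x)%E.
Proof.
move=> mN N0; rewrite setDE integral_mkcondl -setTD [LHS]integral_mkcond.
move: (h \_ D) => {D}h.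
have mTN : measurable (setT `\` N) by rewrite setTD; exact: measurableC.
(* The integral is by definition the difference of those of the positive and negative parts, each a
   supremum over simple functions below; so a nonnegative integrand suffices. *)
suff ge0 (k : T -> \bar R) : (forall x, 0 <= k x)%E ->
    (\int[mu]_x k x = \int[mu]_(x in setT `\` N) k x)%E.
  by rewrite integralE [RHS]integralE; congr (_ - _)%E; apply: ge0 => x.
move=> k0; have kD0 x : (0 <= (k \_ (setT `\` N)) x)%E.
  by rewrite patchE; case: ifP.
have pE (u : {nnsfun T >-> R}) x :
    proj_nnsfun u mTN x = (u \_ (setT `\` N)) x by rewrite (mrestrict u mTN).
rewrite [RHS]integral_mkcond !ge0_integralTE//; apply/eqP; rewrite eq_le.
apply/andP; split; apply: ge_ereal_sup => _ [u /= uk <-].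
(* A simple function below [k], cut to zero on [N], lies below the restriction of [k] and keeps its
   integral because [N] is null. *)
- apply: ereal_sup_ubound; exists (proj_nnsfun u mTN).
    by move=> x; rewrite pE !patchE; case: ifP.
  rewrite -!integralT_nnsfun [RHS](ge0_negligible_integral mN)//; last 2 first.
  + exact/measurable_EFinP.
  + by move=> x _; rewrite lee_fin.
  rewrite [RHS]integral_mkcond; apply: eq_integral => x _.
  by rewrite pE !patchE; case: ifP.
- apply: ereal_sup_ubound; exists u => //= x.
  by apply: le_trans (uk x) _; rewrite patchE; case: ifP.
Qed.

(** The negative part is dominated by the constant [|C|], integrable for a finite measure, so only
    the positive part can diverge. This turns finiteness of the functional at the minimizer into
    integrability of both terms. *)
Lemma integral_bounded_below (disp : measure_display) (T : measurableType disp)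
    (R : realType) (mu : {finite_measure set T -> \bar R}) (D : set T)
    (h : T -> R) (C : R) :
  measurable D -> measurable_fun D h -> (forall x, D x -> - C <= h x) ->
  (-oo < \int[mu]_(x in D) (h x)%:E)%E /\
  ((\int[mu]_(x in D) (h x)%:E < +oo)%E -> mu.-integrable D (EFin \o h)).
Proof.
move=> mD mh hC.
have mE : measurable_fun D (EFin \o h) by exact/measurable_EFinP.
have ineg : mu.-integrable D ((EFin \o h)^\-)%E.
  apply: (@le_integrable _ _ _ mu D mD _ (EFin \o cst `|C|)).
  - exact: measurable_funeneg.
  - move=> x Dx; rewrite gee0_abs ?funeneg_ge0//= normr_id.
    rewrite funenegE /= -EFin_max lee_fin ge_max normr_ge0 andbT.
    by rewrite (le_trans _ (ler_norm C))// lerNl hC.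
  - exact: finite_measure_integrable_cst.
have /fin_numPlt/andP[_ nlty] := integrable_fin_num mD ineg.
have nge0 : (0 <= \int[mu]_(x in D) (EFin \o h)^\- x)%E by exact: integral_ge0.
have pge0 : (0 <= \int[mu]_(x in D) (EFin \o h)^\+ x)%E by exact: integral_ge0.
have /fineK nE := integrable_fin_num mD ineg.
rewrite -/((EFin \o h) _) integralE -nE; split.
  by rewrite (@lt_le_trans _ _ (- (fine (\int[mu]_(x in D) (EFin \o h)^\- x))%:E)%E)
    // ?ltNyr// leeDr.
move=> plty; apply/integrableP; split => //.
under eq_integral do rewrite -[(`|_|)%E]/((abse \o (EFin \o h)) _) fune_abse.
rewrite ge0_integralD//; [|exact: measurable_funepos|exact: measurable_funeneg].
rewrite lte_add_pinfty//.
move: plty; case: (\int[mu]_(x in D) (EFin \o h)^\+ x)%E pge0 => [r|//|//] _ _.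
exact: ltry.
Qed.

(** Dominated convergence: the Lipschitz bound makes [C] a dominating constant for the quotients,
    and [G] is measurable as their pointwise limit. *)
Lemma Rintegral_quotient_cvg (disp : measure_display) (T : measurableType disp)
    (R : realType) (mu : {finite_measure set T -> \bar R}) (D : set T)
    (u : nat -> T -> R) (u0 G : T -> R) (s : nat -> R) (C : R) :
  measurable D -> (forall n, 0 < s n) ->
  (forall n, measurable_fun D (u n)) -> mu.-integrable D (EFin \o u0) ->
  (forall n x, D x -> `|u n x - u0 x| <= C * s n) ->
  (forall x, D x -> (u n x - u0 x) / s n @[n --> \oo] --> G x) ->
  [/\ mu.-integrable D (EFin \o G),
      (forall n, mu.-integrable D (EFin \o u n)) &
      (\int[mu]_(x in D) u n x - \int[mu]_(x in D) u0 x) / s n @[n --> \oo]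
        --> \int[mu]_(x in D) G x].
Proof.
move=> mD s0 mu_ iu0 uC uG.
have mu0 : measurable_fun D u0.
  by apply/measurable_EFinP; exact: measurable_int iu0.
have md n : measurable_fun D (fun x => u n x - u0 x) by exact: measurable_funB.
have id n : mu.-integrable D (EFin \o (fun x => u n x - u0 x)).
  apply: (@le_integrable _ _ _ mu D mD _ (EFin \o cst `|C * s n|)).
  - exact/measurable_EFinP.
  - move=> x Dx /=; rewrite lee_fin normr_id.
    by rewrite (le_trans (uC n x Dx))// ler_norm.
  - exact: finite_measure_integrable_cst.
have iu n : mu.-integrable D (EFin \o u n).
  apply: (@eq_integrable _ _ _ mu D mD _ _ _ (integrableD mD (id n) iu0)).
  by move=> x _ /=; rewrite -EFinD subrK.
pose q n x := ((u n x - u0 x) / s n)%:E.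
have mq n : measurable_fun D (q n).
  by apply/measurable_EFinP; apply: measurable_funM.
have qC n x : D x -> (`|q n x| <= (EFin \o cst C) x)%E.
  move=> Dx; rewrite /q /= lee_fin normrM normfV (gtr0_norm (s0 n)).
  by rewrite ler_pdivrMr// uC.
have qG x : D x -> q ^~ x @ \oo --> (EFin \o G) x.
  by move=> Dx; apply: cvg_EFin; [exact: nearW|exact: uG].
have mG : measurable_fun D (EFin \o G) by exact: (emeasurable_fun_cvg _ _ mq qG).
have iC : mu.-integrable D (EFin \o cst C) by exact: finite_measure_integrable_cst.
have [iG _ cvgI] := dominated_convergence mD mq mG (aeW _ qG) iC
  (aeW _ (fun x n Dx => qC n x Dx)).
split => //.
have -> : (fun n => (\int[mu]_(x in D) u n x - \int[mu]_(x in D) u0 x) / s n) =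
    (fun n => fine (\int[mu]_(x in D) q n x)%E).
  apply/funext => n; rewrite -RintegralB// -RintegralZr//.
by apply: fine_cvg; rewrite fineK//; exact: integrable_fin_num.
Qed.

(** * Measurability of convex functions and of conjugates *)

Lemma lower_semicontinuous_subspace_measurable (R : realType) (d : nat)
    (X : set 'rV[R]_d) (h : 'rV[R]_d -> \bar R) :
  measurable (X : set (borel R d)) ->
  lower_semicontinuous (h : subspace X -> \bar R) ->
  measurable_fun (X : set (borel R d)) (h : borel R d -> \bar R).
Proof.
move=> mX lsch.
apply: (measurability _ (ErealGenOInfty.measurableE R)).
move=> /= _ [_ [a ->]] <-; rewrite preimage_itvoy.
have : open ([set x | (a%:E < h x)%E] : set (subspace X)).
  by move: a; exact/lower_semicontinuousP.
(* A relatively open superlevel set is the trace on [X] of an open set [V], hence Borel because [X]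
   is. *)
move=> /open_subspaceP[V oV VE].
rewrite setIC -VE; apply: measurableI => //.
exact: sub_sigma_algebra.
Qed.

(** A strict superlevel set of a supremum is the union of those of its members. Here each member is
    an affine function of [y] or an infinite constant, so the union, however large, is open. *)
Lemma conjugate_measurable (R : realType) (d : nat) (X : set 'rV[R]_d)
    (h : 'rV[R]_d -> \bar R) :
  measurable_fun setT (conjugate X h : borel R d -> \bar R).
Proof.
apply: (measurability _ (ErealGenOInfty.measurableE R)).
move=> /= _ [_ [a ->]] <-; rewrite preimage_itvoy setTI.
apply: sub_sigma_algebra.
rewrite [X in open X](_ : _ = \bigcup_(x in X)
  (inner x @^-1` [set r | a%:E < r%:E - h x]%E)); last first.
  apply/seteqP; split => y /=.
    by move=> /ereal_sup_gt[_ [x Xx <-]] ax; exists x.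
  by move=> [x Xx /= ax]; apply: (lt_le_trans ax); apply: ereal_sup_ubound; exists x.
apply: bigcup_open => x Xx; apply: open_comp.
  move=> y _; move: y; apply: continuous_big => [|i _]; first exact: add_continuous.
  move=> y.
  by have /(@cvgMl_tmp _ _ _ _ _ (x 0 i)) := @coord_continuous R 1 d 0 i y; exact.
case: (h x) => [r||].
- rewrite (_ : mkset _ = `]a + r, +oo[%classic); first exact: interval_open.
  by apply/seteqP; split => z /=; rewrite in_itv/= andbT -EFinB lte_fin ltrBrDr.
- rewrite (_ : mkset _ = set0); first exact: open0.
  by apply/seteqP; split => z.
- rewrite (_ : mkset _ = setT); first exact: openT.
  by apply/seteqP; split => z //= _; rewrite ltry.
Qed.

(** * Elementary bounds on the conjugate *)

Lemma eq_conjugate (R : realType) (d : nat) (X : set 'rV[R]_d)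
    (h k : 'rV[R]_d -> \bar R) :
  (forall x, X x -> h x = k x) -> conjugate X h = conjugate X k.
Proof.
move=> hk; apply/funext => y; congr ereal_sup.
by apply: eq_imagel => x Xx; rewrite hk.
Qed.

Lemma conjugate_ubound (R : realType) (d : nat) (X : set 'rV[R]_d)
    (p : 'rV[R]_d -> R) (y x : 'rV[R]_d) :
  conjugate X (EFin \o p) y \is a fin_num -> X x ->
  inner x y - p x <= fine (conjugate X (EFin \o p) y).
Proof.
move=> /fineK yfin Xx; rewrite -lee_fin yfin EFinB.
by apply: ereal_sup_ubound; exists x.
Qed.

(** The point [x0] keeps the supremum above [-oo], so a real upper bound on all members also gives
    finiteness. *)
Lemma conjugate_le (R : realType) (d : nat) (X : set 'rV[R]_d)
    (p : 'rV[R]_d -> R) (y x0 : 'rV[R]_d) (b : R) :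
  X x0 -> (forall x, X x -> inner x y - p x <= b) ->
  conjugate X (EFin \o p) y \is a fin_num /\
  fine (conjugate X (EFin \o p) y) <= b.
Proof.
move=> Xx0 xb.
have le_b : (conjugate X (EFin \o p) y <= b%:E)%E.
  by apply: ge_ereal_sup => _ [x Xx <-] /=; rewrite -EFinB lee_fin xb.
have gt_Noo : (-oo < conjugate X (EFin \o p) y)%E.
  apply: (@lt_le_trans _ _ (inner x0 y - p x0)%:E); first exact: ltNyr.
  by rewrite EFinB; apply: ereal_sup_ubound; exists x0.
have fin : conjugate X (EFin \o p) y \is a fin_num.
  by rewrite fin_numElt gt_Noo (le_lt_trans le_b)// ltry.
by split => //; rewrite -lee_fin fineK.
Qed.

(** Conjugation is 1-Lipschitz for the uniform distance on [X]. Finiteness therefore passes from the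
    minimizing parameter to nearby ones. *)
Lemma conjugate_dist (R : realType) (d : nat) (X : set 'rV[R]_d)
    (p q : 'rV[R]_d -> R) (y x0 : 'rV[R]_d) (K : R) :
  X x0 -> conjugate X (EFin \o p) y \is a fin_num ->
  (forall x, X x -> `|q x - p x| <= K) ->
  conjugate X (EFin \o q) y \is a fin_num /\
  `|fine (conjugate X (EFin \o q) y) - fine (conjugate X (EFin \o p) y)| <= K.
Proof.
move=> Xx0 pfin pqK.
have pq x : X x -> inner x y - q x <= fine (conjugate X (EFin \o p) y) + K.
  move=> Xx; have := conjugate_ubound pfin Xx; have := pqK x Xx.
  by rewrite ler_norml; lra.
have [qfin q_le] := conjugate_le Xx0 pq.
split => //; have [|_ p_le] :=
    @conjugate_le _ _ _ p y _ (fine (conjugate X (EFin \o q) y) + K) Xx0.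
  move=> x Xx; have := conjugate_ubound qfin Xx; have := pqK x Xx.
  by rewrite ler_norml; lra.
by rewrite ler_norml; apply/andP; split; lra.
Qed.

(** * Near-maximizers and the envelope formula *)

(** The inequality [inner x z - p x <= F z], tested at [z = y + r e_i] and [z = y - r e_i], squeezes
    the [i]-th coordinate of a near-maximizer between two difference quotients of [F], both close to
    the partial derivative. *)
Lemma conjugate_near_maximizer (R : realType) (d : nat) (X : set 'rV[R]_d)
    (p : 'rV[R]_d -> R) (y : 'rV[R]_d) (e : R) :
  let F := conjugate X (EFin \o p) in
  ediff F y -> 0 < e ->
  exists2 eta : R, 0 < eta & forall x, X x ->
    fine (F y) - eta <= inner x y - p x ->
    forall i, `|x 0 i - egrad F y 0 i| <= e.
Proof.
move=> F [Ffin Fdiff] e0; set c := fine \o F in Fdiff.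
pose v i : 'rV[R]_d := delta_mx 0 i.
have near_quot i : \forall r \near (0 : R)^',
    `|egrad F y 0 i - r^-1 * (c (r *: v i + y) - c y)| < e / 2.
  have /= := @diff_derivable _ _ _ _ _ (v i) Fdiff.
  rewrite /derivable => /cvgrPdist_lt /(_ (e / 2)).
  rewrite divr_gt0// mxE => /(_ isT); exact.
have near_fin i : \forall r \near (0 : R)^', F (r *: v i + y) \is a fin_num.
  have : (r *: v i + y) @[r --> (0 : R)^'] --> 0 *: v i + y.
    apply: cvgD; last exact: cvg_cst.
    apply: cvgZr_tmp; apply: cvg_within_filter; exact: cvg_id.
  rewrite scale0r add0r => h; exact: (h _ Ffin).
(* There are finitely many coordinates, so one radius [D] serves them all. *)
have : \forall r \near (0 : R)^', forall i : 'I_d,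
    `|egrad F y 0 i - r^-1 * (c (r *: v i + y) - c y)| < e / 2 /\
    F (r *: v i + y) \is a fin_num.
  apply: filter_forall => i.
  by near=> r; split; near: r; [exact: near_quot|exact: near_fin].
move=> /nbhs_ballP[D /= D0 HD].
have yfin : F y \is a fin_num := nbhs_singleton Ffin.
have step x i (r : R) : X x -> 0 < `|r| < D ->
    inner x y - p x <= c y + r * (egrad F y 0 i - x 0 i) + `|r| * (e / 2).
  move=> Xx /andP[r0 rD].
  have rn0 : r != 0 by rewrite -normr_gt0.
  have [|//|hq hfin] := HD r _ _ i; first by rewrite /ball/= sub0r normrN.
  have := conjugate_ubound hfin Xx.
  rewrite -/F -[fine _]/(c (r *: v i + y)).
  have -> : inner x (r *: v i + y) = r * x 0 i + inner x y.
    rewrite /inner (eq_bigr (fun j => r * (x 0 j * v i 0 j) + x 0 j * y 0 j)).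
      rewrite big_split/= -mulr_sumr (bigD1 i)//= big1 ?addr0 /v.
        by rewrite mxE !eqxx mulr1.
      by move=> j ji; rewrite mxE (negbTE ji) andbF mulr0.
    by move=> j _; rewrite !mxE; ring.
  set g := egrad F y 0 i in hq *; set cr := c (r *: v i + y) in hq *.
  have : `|r * g - (cr - c y)| <= `|r| * (e / 2).
    have -> : r * g - (cr - c y) = r * (g - r^-1 * (cr - c y)).
      by rewrite mulrBr mulrA divff// mul1r.
    by rewrite normrM ler_pM2l// ltW.
  by rewrite ler_norml => /andP[+ _]; lra.
pose r := D / 2.
have r0 : 0 < r by rewrite divr_gt0.
have rD : r < D by rewrite ltr_pdivrMr// ltr_pMr// ltr1n.
(* The loss [eta] and the differentiability error each contribute [r * (e / 2)]; they add up to
   [r * e]. *)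
exists (r * (e / 2)); first by rewrite mulr_gt0// divr_gt0.
move=> x Xx xmax i.
have hp : 0 < `|r| < D by rewrite gtr0_norm// r0.
have hm : 0 < `|- r| < D by rewrite normrN.
have := step x i _ Xx hp; have := step x i _ Xx hm.
rewrite normrN (gtr0_norm r0) => hm' hp'.
suff : r * `|x 0 i - egrad F y 0 i| <= r * e by rewrite ler_pM2l.
rewrite -{1}(gtr0_norm r0) -normrM ler_norml; apply/andP; split.
  by rewrite /c /= in hm' hp'; lra.
by rewrite /c /= in hm' hp'; lra.
Unshelve. all: by end_near. Qed.

(* Only near-maximizers are used, so the maximum need not be attained: those of
   [p 0] cluster at [T], and the others cannot compete for small [s]. *)
Lemma conjugate_envelope (R : realType) (d : nat) (X : set 'rV[R]_d)
    (p : R -> 'rV[R]_d -> R) (y : 'rV[R]_d) (C : R) :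
  let F s := conjugate X (EFin \o p s) in
  let T := egrad (F 0) y in
  ediff (F 0) y -> X T ->
  (\forall s \near (0 : R), forall x, X x -> `|p s x - p 0 x| <= C * `|s|) ->
  (forall e : R, 0 < e -> \forall x \near T & s \near (0 : R), X x ->
    `|p s x - p 0 x - (p s T - p 0 T)| <= e * `|s|) ->
  forall e : R, 0 < e -> \forall s \near (0 : R),
    `|fine (F s y) - fine (F 0 y) + (p s T - p 0 T)| <= e * `|s|.
Proof.
move=> F T Fdiff XT pC pT e e0.
have yfin : F 0 y \is a fin_num by case: Fdiff => /nbhs_singleton.
have [[/= A B] [/nbhs_ballP[D /= D0 DA] B0] AB] := pT e e0.
have D20 : 0 < D / 2 by rewrite divr_gt0.
have [eta eta0 near_max] := conjugate_near_maximizer Fdiff D20.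
(* A point missing the supremum by more than [eta] cannot compete: [C * |s|] covers the change at
   [T], and another [C * |s|] covers the change of the conjugate or of [p] at that point. The
   [|C| + 1] below allows for a [C] that is zero or negative. *)
have C_eta : \forall s \near (0 : R), 2 * (C * `|s|) <= eta.
  have C1 : 0 < 2 * (`|C| + 1) by rewrite mulr_gt0// ltr_wpDl.
  near=> s; have : `|s| <= (2 * (`|C| + 1))^-1 * eta.
    by near: s; apply: (@nbhs0_le R R^o); rewrite mulr_gt0// invr_gt0.
  rewrite ler_pdivlMl// -mulrA; apply: le_trans; rewrite ler_pM2l// ler_wpM2r//.
  by rewrite (le_trans (ler_norm C))// lerDl.
near=> s.
have sB : B s by near: s.
have sC : forall x, X x -> `|p s x - p 0 x| <= C * `|s| by near: s.
have s_eta : 2 * (C * `|s|) <= eta by near: s.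
have [sfin] := conjugate_dist XT yfin sC.
rewrite -/(F s) -/(F 0) => Fdist.
have TC := sC T XT.
have es0 : 0 <= e * `|s| by rewrite mulr_ge0// ltW.
have max_expansion x : X x -> fine (F 0 y) - eta <= inner x y - p 0 x ->
    `|p s x - p 0 x - (p s T - p 0 T)| <= e * `|s|.
  move=> Xx xmax; apply: (AB (x, s)) => //; split => //=; apply: DA.
  split=> // i j; rewrite ord1 /ball/= distrC.
  rewrite (le_lt_trans (near_max x Xx xmax j))//.
  by rewrite ltr_pdivrMr// ltr_pMr// ltr1n.
(* Each half bounds one supremum pointwise: near-maximizers of [p 0] by the expansion around [T],
   other points by the gap [eta]. *)
rewrite ler_norml; apply/andP; split.
- suff : fine (F 0 y) <= fine (F s y) + (p s T - p 0 T) + e * `|s| by lra.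
  apply: (conjugate_le XT _).2 => x Xx.
  have ubx := conjugate_ubound sfin Xx; rewrite -/(F s) in ubx.
  have [xmax|xmax] := leP (fine (F 0 y) - eta) (inner x y - p 0 x).
    by have := max_expansion x Xx xmax; rewrite ler_norml; lra.
  by move: Fdist TC; rewrite !ler_norml; lra.
- suff : fine (F s y) <= fine (F 0 y) - (p s T - p 0 T) + e * `|s| by lra.
  apply: (conjugate_le XT _).2 => x Xx.
  have ubx := conjugate_ubound yfin Xx; rewrite -/(F 0) in ubx.
  have [xmax|xmax] := leP (fine (F 0 y) - eta) (inner x y - p 0 x).
    by have := max_expansion x Xx xmax; rewrite ler_norml; lra.
  by move: (sC x Xx) TC; rewrite !ler_norml; lra.
Unshelve. all: by end_near. Qed.

(** * Expansion of the family along a line of parameters *)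

Lemma norm2_coord_le (R : realType) (n : nat) (u : 'rV[R]_n) (i : 'I_n) :
  `|u 0 i| <= norm2 u.
Proof.
rewrite -sqrtr_sqr ler_wsqrtr// (bigD1 i)//= lerDl.
by apply: sumr_ge0 => j _; exact: sqr_ge0.
Qed.

Lemma inner_norm2_le (R : realType) (n : nat) (u v : 'rV[R]_n) :
  `|inner u v| <= norm2 u * \sum_i `|v 0 i|.
Proof.
rewrite mulr_sumr (le_trans (ler_norm_sum _ _ _))// ler_sum// => i _.
by rewrite normrM ler_wpM2r// norm2_coord_le.
Qed.

Lemma is_derive_along_line (R : realType) (n : nat) (F : 'rV[R]_n -> \bar R)
    (a v : 'rV[R]_n) (s : R) :
  ediff F (a + s *: v) ->
  is_derive s 1 (fun r : R => fine (F (a + r *: v))) (inner (egrad F (a + s *: v)) v).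
Proof.
move=> [_ Fdiff]; set c := fine \o F in Fdiff.
have quotE : (fun r : R => r^-1 *: (((fun t : R => c (a + t *: v)) \o shift s) (r *: 1)
    - c (a + s *: v))) =
    (fun r => r^-1 *: ((c \o shift (a + s *: v)) (r *: v) - c (a + s *: v))).
  apply/funext => r /=; rewrite [r *: 1]mulr1 scalerDl.
  by rewrite [r *: v + (a + _)]addrCA.
apply: DeriveDef.
  rewrite /derivable /=.
  have := @diff_derivable _ _ _ c _ v Fdiff; rewrite /derivable.
  by rewrite -quotE.
transitivity ('D_v (c : 'rV[R]_n -> R^o) (a + s *: v)).
  by rewrite /derive -quotE.
rewrite deriveE// /inner.
under eq_bigr => i _ do rewrite mxE deriveE//.
move: ('d _ _) => L; rewrite [in LHS](row_sum_delta v) linear_sum.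
by apply: eq_bigr => i _; rewrite linearZ/= mulrC.
Qed.

(** Mean value theorem on the segment between [0] and [s], on either side of [0]. *)
Lemma is_derive_lipschitz (R : realType) (h dh : R -> R) (b K : R) :
  (forall s : R, `|s| <= b -> is_derive s 1 h (dh s)) ->
  (forall s : R, `|s| <= b -> `|dh s| <= K) ->
  forall s : R, `|s| <= b -> `|h s - h 0| <= K * `|s|.
Proof.
move=> hdh dhK.
have lip u w : - b <= u -> u <= w -> w <= b -> `|h w - h u| <= K * (w - u).
  move=> bu uw wb.
  have in_b z : u <= z <= w -> `|z| <= b.
    by rewrite ler_norml => /andP[? ?]; apply/andP; split; lra.
  have [||z] := @MVT_segment R h dh u w uw.
  - move=> z; rewrite in_itv/= => /andP[uz zw]; apply: hdh; apply: in_b.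
    by rewrite !ltW.
  - apply: derivable_within_continuous => z; rewrite in_itv/= => /in_b /hdh [].
    by [].
  rewrite in_itv/= => /in_b /dhK dK ->.
  by rewrite normrM [`|w - u|]ger0_norm ?subr_ge0// ler_wpM2r// subr_ge0.
move=> s; rewrite ler_norml => /andP[bs sb].
have [s0|s0] := leP 0 s.
  by have := lip 0 s; rewrite subr0 (ger0_norm s0); apply => //; lra.
have := lip s 0; rewrite sub0r distrC (ltr0_norm s0); apply => //; lra.
Qed.

Lemma near_line (R : realType) (n : nat) (a v : 'rV[R]_n) (P : set 'rV[R]_n) :
  (\forall t \near a, P t) ->
  exists2 b : R, 0 < b & forall s : R, `|s| <= b -> P (a + s *: v).
Proof.
move=> aP; have : (a + s *: v) @[s --> (0 : R)] --> a + 0 *: v.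
  by apply: cvgD; [exact: cvg_cst|apply: cvgZr_tmp; exact: cvg_id].
rewrite scale0r addr0 => /(_ _ aP) /nbhs_ballP[b /= b0 bP].
exists (b / 2); first by rewrite divr_gt0.
move=> s sb; apply: bP; rewrite /ball/= sub0r normrN (le_lt_trans sb)//.
by rewrite ltr_pdivrMr// ltr_pMr// ltr1n.
Qed.

Lemma innerBl (R : realType) (n : nat) (u w v : 'rV[R]_n) :
  inner (u - w) v = inner u v - inner w v.
Proof. by rewrite /inner -sumrB; apply: eq_bigr => i _; rewrite !mxE mulrBl. Qed.

(** Gathers what the envelope formula asks of the family: a Lipschitz bound in [s] uniform over [X],
    from the gradient bound, and increments in [s] that agree near [T] up to [e * |s|], from the
    continuity of the gradient. *)
Lemma directional_expansion (R : realType) (d M : nat)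
    (X : set 'rV[R]_d) (Theta : set 'rV[R]_M)
    (f : 'rV[R]_d -> 'rV[R]_M -> \bar R) (a v : 'rV[R]_M) :
  let p (s : R) x := fine (f x (a + s *: v)) in
  theta_differentiable X Theta f ->
  theta_gradient_continuous X Theta f ->
  theta_gradient_bounded X Theta f ->
  Theta° a ->
  exists b C : R, [/\ 0 < b,
    (forall s : R, `|s| <= b -> Theta° (a + s *: v)),
    (forall (s : R) x, `|s| <= b -> X x -> `|p s x - p 0 x| <= C * `|s|),
    (forall T, X T -> forall e : R, 0 < e ->
      \forall x \near T & s \near (0 : R), X x ->
        `|p s x - p 0 x - (p s T - p 0 T)| <= e * `|s|) &
    (forall x, X x -> is_derive (0 : R) 1 (p ^~ x) (inner (egrad (f x) a) v))].
Proof.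
move=> p f_diff f_cont f_bound a_int.
have [b b0 b_int] : exists2 b : R, 0 < b &
    forall s : R, `|s| <= b -> Theta° (a + s *: v).
  by apply: near_line; exact: (open_nbhs_nbhs (conj (@open_interior _ _) a_int)).
have [L L0 /(near_line v)[b' b'0 b'L]] := f_bound a (interior_subset a_int).
have p_der x (s : R) : X x -> `|s| <= b ->
    is_derive s 1 (p ^~ x) (inner (egrad (f x) (a + s *: v)) v).
  by move=> Xx sb; apply: is_derive_along_line; apply: f_diff => //; exact: b_int.
have m0 : 0 < Order.min b b' by rewrite lt_min b0.
(* [b] keeps the segment in the interior of [Theta], [b'] keeps it where the gradient is bounded by
   [L]; the sum bounds the pairing with [v]. *)
exists (Order.min b b'), (L * \sum_i `|v 0 i|); split => //.
- by move=> s; rewrite le_min => /andP[/b_int].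
- move=> s x sm Xx.
  apply: (@is_derive_lipschitz R (p ^~ x)
    (fun s => inner (egrad (f x) (a + s *: v)) v) (Order.min b b')) => // r.
    by rewrite le_min => /andP[rb _]; exact: p_der.
  rewrite le_min => /andP[rb rb']; rewrite (le_trans (inner_norm2_le _ _))//.
  rewrite ler_wpM2r ?sumr_ge0// ltW//; apply: b'L => //; exact: b_int.
- move=> T XT e e0.
  have V0 : 0 <= \sum_i `|v 0 i| by rewrite sumr_ge0.
  (* The added [1] keeps the divisor positive when [v] is zero. *)
  have V1 : 0 < \sum_i `|v 0 i| + 1 by rewrite ltr_wpDl.
  have [[/= A B] [A0 /(near_line v)[c c0 cB] AB]] :=
    f_cont T a XT a_int (e / (\sum_i `|v 0 i| + 1)) (divr_gt0 e0 V1).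
  have m'0 : 0 < Order.min b c by rewrite lt_min b0.
  exists (A, [set s : R | `|s| <= Order.min b c]).
    by split => //=; exact: (@nbhs0_le R R^o).
  move=> [x s] [/= Ax sm] Xx.
  (* Regrouped as the increment of [p s x - p s T] in [s], whose derivative pairs [v] with a
     difference of gradients at one parameter. That difference must be small along the whole
     segment, hence the local uniformity in theta. *)
  rewrite (_ : p s x - p 0 x - (p s T - p 0 T) =
    (p s x - p s T) - (p 0 x - p 0 T)); last by ring.
  apply: (@is_derive_lipschitz R (p ^~ x \- p ^~ T)
    (fun s => inner (egrad (f x) (a + s *: v)) v -
              inner (egrad (f T) (a + s *: v)) v) (Order.min b c)) => // r.
    by rewrite le_min => /andP[rb _]; apply: is_deriveB; exact: p_der.
  rewrite le_min => /andP[rb rc]; rewrite -innerBl.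
  rewrite (le_trans (inner_norm2_le _ _))//.
  apply: (@le_trans _ _ (e / (\sum_i `|v 0 i| + 1) * \sum_i `|v 0 i|)).
    rewrite ler_wpM2r// ltW//; apply: (AB (x, a + r *: v)) => //.
      by split => //=; exact: cB.
    exact: b_int.
  by rewrite -mulrA ler_piMr ?(ltW e0)// ler_pdivrMl// mulr1 lerDl.
- move=> x Xx; have := p_der x 0 Xx; rewrite normr0 scale0r addr0; apply.
  exact: ltW.
Qed.

(** * One-sided first variation at a minimizer *)

(** All integrals are finite, so minimality can be rearranged into nonnegative difference quotients;
    their limit is the sum of the integrals of [G] and [H]. *)
Lemma min_first_variation (d1 d2 : measure_display) (T1 : measurableType d1)
    (T2 : measurableType d2) (R : realType)
    (mu : {finite_measure set T1 -> \bar R})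
    (nu : {finite_measure set T2 -> \bar R})
    (D1 : set T1) (D2 : set T2) (u : nat -> T1 -> R) (w : nat -> T2 -> R)
    (u0 G : T1 -> R) (w0 H : T2 -> R) (s : nat -> R) (C : R) :
  measurable D1 -> measurable D2 -> (forall n, 0 < s n) ->
  (forall n, measurable_fun D1 (u n)) -> (forall n, measurable_fun D2 (w n)) ->
  mu.-integrable D1 (EFin \o u0) -> nu.-integrable D2 (EFin \o w0) ->
  (forall n x, D1 x -> `|u n x - u0 x| <= C * s n) ->
  (forall n y, D2 y -> `|w n y - w0 y| <= C * s n) ->
  (forall x, D1 x -> (u n x - u0 x) / s n @[n --> \oo] --> G x) ->
  (forall y, D2 y -> (w n y - w0 y) / s n @[n --> \oo] --> H y) ->
  (forall n, \int[mu]_(x in D1) (u0 x)%:E + \int[nu]_(y in D2) (w0 y)%:E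
    <= \int[mu]_(x in D1) (u n x)%:E + \int[nu]_(y in D2) (w n y)%:E)%E ->
  [/\ mu.-integrable D1 (EFin \o G), nu.-integrable D2 (EFin \o H) &
      0 <= \int[mu]_(x in D1) G x + \int[nu]_(y in D2) H y].
Proof.
move=> mD1 mD2 s0 mu_ mw iu0 iw0 uC wC uG wH minJ.
have [iG iu cvgu] := Rintegral_quotient_cvg mD1 s0 mu_ iu0 uC uG.
have [iH iw cvgw] := Rintegral_quotient_cvg mD2 s0 mw iw0 wC wH.
split => //; have cvg_sum :
    (\int[mu]_(x in D1) u n x - \int[mu]_(x in D1) u0 x) / s n +
    (\int[nu]_(y in D2) w n y - \int[nu]_(y in D2) w0 y) / s n @[n --> \oo]
    --> \int[mu]_(x in D1) G x + \int[nu]_(y in D2) H y by exact: cvgD.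
rewrite -(cvg_lim _ cvg_sum)//; apply: limr_ge; first exact: cvgP cvg_sum.
apply: nearW => n /=; rewrite -mulrDl divr_ge0 ?(ltW (s0 n))//.
have := minJ n.
rewrite -[X in (X + _ <= _)%E]fineK ?(integrable_fin_num mD1 iu0)//.
rewrite -[X in (_ + X <= _)%E]fineK ?(integrable_fin_num mD2 iw0)//.
rewrite -[X in (_ <= X + _)%E]fineK ?(integrable_fin_num mD1 (iu n))//.
rewrite -[X in (_ <= _ + X)%E]fineK ?(integrable_fin_num mD2 (iw n))//.
by rewrite -!EFinD lee_fin /Rintegral; lra.
Qed.

(** * Compact supports, inner products, derivatives along sequences *)

Lemma compact_inner_bound (R : realType) (d : nat) (K : set 'rV[R]_d) :
  compact K -> exists B : R, forall x y, K x -> `|inner x y| <= B * \sum_i `|y 0 i|.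
Proof.
move=> /compact_bounded [B [_ KB]]; exists (B + 1) => x y Kx.
rewrite mulr_sumr (le_trans (ler_norm_sum _ _ _))// ler_sum// => i _.
rewrite normrM ler_wpM2r// (@le_trans _ _ `|x|)//; last first.
  by apply: KB Kx; rewrite ltrDl.
rewrite [leRHS]/Num.norm/= mx_normrE.
exact: (le_bigmax _ (fun k => `|x k.1 k.2|) (0, i)).
Qed.

Lemma compact_setC_measurable (R : realType) (d : nat) (K : set 'rV[R]_d) :
  compact K -> measurable (~` K : set (borel R d)).
Proof.
move=> cK; apply: sub_sigma_algebra; rewrite openC.
by apply: compact_closed => //; exact: norm_hausdorff.
Qed.

Lemma innerC (R : realType) (d : nat) (x y : 'rV[R]_d) : inner x y = inner y x.
Proof. by apply: eq_bigr => i _; rewrite mulrC. Qed.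

Lemma innerNr (R : realType) (d : nat) (x y : 'rV[R]_d) :
  inner x (- y) = - inner x y.
Proof. by rewrite /inner -sumrN; apply: eq_bigr => i _; rewrite mxE mulrN. Qed.

Lemma is_derive_quotient_cvg (R : realType) (h : R -> R) (l : R) (s : nat -> R) :
  is_derive (0 : R) 1 h l -> s n @[n --> \oo] --> (0 : R) ->
  (forall n, s n != 0) -> (h (s n) - h 0) / s n @[n --> \oo] --> l.
Proof.
move=> [der <-] s_cvg sn0.
(* A derivative is a limit along the punctured neighbourhoods of [0], which the nonzero [s n]
   enter. *)
have s_dn : s n @[n --> \oo] --> (0 : R)^'.
  move=> P /s_cvg sP; rewrite -[_ P]/(\forall n \near \oo, P (s n)).
  by apply: filterS (sP : \forall n \near \oo, s n != 0 -> P (s n)) => n; apply.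
have -> : (fun n => (h (s n) - h 0) / s n) =
    (fun r => r^-1 *: ((h \o shift 0) (r *: 1) - h 0)) \o s.
  by apply/funext => n /=; rewrite addr0 [_ *: 1]mulr1 [_ *: (_ - _)]mulrC.
exact: cvg_comp s_dn der.
Qed.

(** * The first-order condition at an interior minimizer *)

Unset Implicit Arguments.
Set Strict Implicit.

Theorem theorem3p5 (R : realType) (d M : nat)
    (X : set 'rV[R]_d) (Theta : set 'rV[R]_M)
    (f : 'rV[R]_d -> 'rV[R]_M -> \bar R)
    (mu nu : probability (borel R d) R) (tbar : 'rV[R]_M)
    (X_borel : measurable (X : set (borel R d)))
    (mu_on_X : mu X = 1%E)
    (F_cvx : forall t, Theta t -> cvx X (f^~ t))
    (mu_compact : compactly_supported mu)
    (nu_compact : compactly_supported nu)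
    (f_diff : theta_differentiable X Theta f)
    (f_grad_cont : theta_gradient_continuous X Theta f)
    (f_grad_bound : theta_gradient_bounded X Theta f)
    (tbar_min : argmin Theta (Jtilde X f mu nu) tbar)
    (tbar_int : Theta° tbar)
    (T_defined : transport_defined X f nu tbar) :
  forall g : 'rV[R]_d -> R, Tan X f tbar g ->
    (\int[mu]_(x in X) (g x)%:E
      = \int[nu]_y (g (transport X f tbar y))%:E)%E.
Proof.
pose T := transport X f tbar.
have [K1 cK1 muK1] := mu_compact.
have [K2 cK2 nuK2] := nu_compact.
have [N0 [mN0 nuN0 good_N0]] := T_defined.
have [B1 innerB1] := compact_inner_bound cK1.
have [B2 innerB2] := compact_inner_bound cK2.
have mK1 := compact_setC_measurable cK1.
have mK2 := compact_setC_measurable cK2.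
have mN : measurable (~` K2 `|` N0 : set (borel R d)) by exact: measurableU.
have nuN : nu (~` K2 `|` N0) = 0%E by exact: null_set_setU.
(* Discarding null sets leaves domains where pointwise bounds hold everywhere: [D1] lies in [K1],
   and on [D2], inside [K2], the conjugate is differentiable with [T] valued in [X]. *)
pose D1 : set (borel R d) := X `\` ~` K1.
pose D2 : set (borel R d) := setT `\` (~` K2 `|` N0).
have mD1 : measurable D1 by exact: measurableD.
have mD2 : measurable D2 by exact: measurableD.
have D1X x : D1 x -> X x by case.
have D1K x : D1 x -> K1 x by move=> [_ /contrapT].
have D2K y : D2 y -> K2 y by move=> [_ /not_orP[/contrapT]].
have D2T y : D2 y -> ediff (conjugate X (f^~ tbar)) y /\ X (T y).
  by move=> [_ /not_orP[_ N0y]]; apply: contrapT => bad; exact/N0y/good_N0.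
have intX h : (\int[mu]_(x in X) h x = \int[mu]_(x in D1) h x)%E.
  exact: integral_setDnull.
have intT h : (\int[nu]_y h y = \int[nu]_(y in D2) h y)%E.
  exact: integral_setDnull.
(* A point where the conjugate is finite gives an affine minorant of [p tbar]. It exists because
   [nu] has mass one. *)
have [y0 D2y0] : exists y, D2 y.
  apply/set0P/negP => /eqP D20.
  have : nu setT = 0%E.
    apply: (@subset_measure0 _ _ _ nu setT (~` K2 `|` N0)) => // y _.
    by apply: contrapT => Ny; rewrite -[False]/(set0 y) -D20.
  by rewrite probability_setT => /eqP; rewrite onee_eq0.
have Theta_tbar := interior_subset tbar_int.
have [_ _ _ [x0 Xx0 _] _] := F_cvx tbar Theta_tbar.
pose p t x := fine (f x t).
have pE t x : Theta° t -> X x -> f x t = (p t x)%:E.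
  move=> Tt Xx; rewrite /p fineK//.
  by have [/nbhs_singleton] := f_diff x t Xx Tt.
have conjE t : Theta° t -> conjugate X (f^~ t) = conjugate X (EFin \o p t).
  by move=> Tt; apply: eq_conjugate => x Xx; exact: pE.
have mp t : Theta° t -> measurable_fun D1 (p t).
  move=> Tt; apply/measurable_EFinP.
  apply: (@eq_measurable_fun _ _ _ _ D1 (f^~ t)).
    by move=> x; rewrite inE => /D1X Xx; rewrite /= -pE.
  have [_ _ _ _ lsc] := F_cvx t (interior_subset Tt).
  apply: (measurable_funS X_borel D1X).
  exact: lower_semicontinuous_subspace_measurable.
pose q t y := fine (conjugate X (EFin \o p t) y).
have mq t : measurable_fun D2 (q t).
  apply: measurable_funTS; apply: measurableT_comp; first exact: fine_measurable.
  exact: conjugate_measurable.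
have qfin y : D2 y -> conjugate X (EFin \o p tbar) y \is a fin_num.
  by move=> /D2T[[/nbhs_singleton]]; rewrite conjE.
have JE t : Theta° t ->
    (forall y, D2 y -> conjugate X (EFin \o p t) y \is a fin_num) ->
    (Jtilde X f mu nu t =
     \int[mu]_(x in D1) (p t x)%:E + \int[nu]_(y in D2) (q t y)%:E)%E.
  move=> Tt tfin; rewrite /Jtilde intX intT conjE//; congr (_ + _)%E.
    by apply: eq_integral => x; rewrite inE => /D1X Xx; exact: pE.
  by apply: eq_integral => y; rewrite inE => D2y; rewrite /q fineK// tfin.
(* The inequality [inner x y <= p tbar x + q tbar y], with [y0] or [x0] fixed, bounds [p tbar] and
   [q tbar] below on the compact sets. Neither integral is [-oo], and their sum is below [+oo] at
   the minimizer, so both are finite. *)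
have [ip iq] : mu.-integrable D1 (EFin \o p tbar) /\
               nu.-integrable D2 (EFin \o q tbar).
  have [|pNy p_int] := @integral_bounded_below _ _ _ mu D1 (p tbar)
    (q tbar y0 + B1 * \sum_i `|y0 0 i|) mD1 (mp _ tbar_int).
    move=> x D1x; have := conjugate_ubound (qfin _ D2y0) (D1X _ D1x).
    by have := innerB1 x y0 (D1K _ D1x); rewrite ler_norml /q; lra.
  have [|qNy q_int] := @integral_bounded_below _ _ _ nu D2 (q tbar)
    (p tbar x0 + B2 * \sum_i `|x0 0 i|) mD2 (mq _).
    move=> y D2y; have := conjugate_ubound (qfin _ D2y) Xx0.
    by have := innerB2 y x0 (D2K _ D2y); rewrite innerC ler_norml /q; lra.
  have [_ + _] := tbar_min; rewrite JE// => Jlty.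
  split; [apply: p_int|apply: q_int]; move: pNy qNy Jlty;
    by case: (\int[mu]_(x in D1) _)%E => [?||]; case: (\int[nu]_(y in D2) _)%E => [?||];
      rewrite ?ltry.
pose G v x := inner (egrad (f x) tbar) v.
have variation v : [/\ mu.-integrable D1 (EFin \o G v),
    nu.-integrable D2 (EFin \o (fun y => - G v (T y))) &
    0 <= \int[mu]_(x in D1) G v x + \int[nu]_(y in D2) - G v (T y)].
  have [b [C [b0 b_int p_lip p_unif p_der]]] :=
    directional_expansion v f_diff f_grad_cont f_grad_bound tbar_int.
  (* Positive steps of size at most [b], so every [tbar + s n *: v] is an admissible interior
     parameter. *)
  pose s n : R := b / n.+1%:R.
  have s0 n : 0 < s n by rewrite divr_gt0.
  have sb n : `|s n| <= b.
    by rewrite gtr0_norm// ler_pdivrMr// ler_peMr ?ler1n// ltW.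
  have s_cvg : s n @[n --> \oo] --> (0 : R).
    rewrite -(mulr0 b); apply: cvgMl_tmp; exact: cvg_harmonic.
  have line0 : tbar + 0 *: v = tbar by rewrite scale0r addr0.
  have pG x : X x ->
      (p (tbar + s n *: v) x - p tbar x) / s n @[n --> \oo] --> G v x.
    move=> Xx; rewrite -{2}line0.
    apply: (is_derive_quotient_cvg (p_der x Xx) s_cvg) => n.
    by rewrite gt_eqF.
  have fin_dist n y : D2 y ->
      conjugate X (EFin \o p (tbar + s n *: v)) y \is a fin_num /\
      `|q (tbar + s n *: v) y - q tbar y| <= C * s n.
    move=> D2y; apply: (conjugate_dist Xx0 (qfin _ D2y)) => x Xx.
    by have := p_lip _ x (sb n) Xx; rewrite line0 (gtr0_norm (s0 n)).
  apply: (@min_first_variation _ _ _ _ _ mu nu D1 D2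
    (fun n => p (tbar + s n *: v)) (fun n => q (tbar + s n *: v))
    (p tbar) (G v) (q tbar) (fun y => - G v (T y)) s C) => //.
  - move=> n. exact: mp (b_int _ (sb n)).
  - move=> n x /D1X Xx; have := p_lip _ x (sb n) Xx.
    by rewrite line0 (gtr0_norm (s0 n)).
  - by move=> n y /(fin_dist n)[].
  - by move=> x /D1X; exact: pG.
  - move=> y D2y; have [Fdiff XT] := D2T y D2y.
    have TE : T y = egrad (conjugate X (EFin \o p (tbar + 0 *: v))) y.
      by rewrite line0 -conjE.
    have XT0 : X (egrad (conjugate X (EFin \o p (tbar + 0 *: v))) y) by rewrite -TE.
    rewrite conjE// -{1}line0 in Fdiff.
    have p_lip0 : \forall r \near (0 : R), forall x, X x ->
        `|p (tbar + r *: v) x - p (tbar + 0 *: v) x| <= C * `|r|.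
      by apply: filterS (@nbhs0_le R R^o b b0) => r rb x Xx; exact: p_lip.
    have env := @conjugate_envelope R d X (fun r => p (tbar + r *: v)) y C
      Fdiff XT0 p_lip0 (p_unif _ XT0).
    (* The envelope formula divided by [s n]: the quotients of [q] at [y] and of [p] at [T y] cancel
       in the limit. Subtracting the latter gives the limit [- G v (T y)]. *)
    have rem0 : (q (tbar + s n *: v) y - q tbar y +
        (p (tbar + s n *: v) (T y) - p tbar (T y))) / s n @[n --> \oo] --> (0 : R).
      apply/cvgrPdist_le => e e0; have env_e := env e e0.
      rewrite -TE line0 in env_e.
      have {}env_e : \forall n \near \oo,
          `|q (tbar + s n *: v) y - q tbar y +
            (p (tbar + s n *: v) (T y) - p tbar (T y))| <= e * `|s n|.
        exact: s_cvg env_e.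
      apply: filterS env_e => n; rewrite (gtr0_norm (s0 n)) => env_n.
      by rewrite sub0r normrN normrM normfV (gtr0_norm (s0 n)) ler_pdivrMr.
    rewrite -[- G v _]sub0r (_ : (fun n => _) =
        (fun n => (q (tbar + s n *: v) y - q tbar y +
        (p (tbar + s n *: v) (T y) - p tbar (T y))) / s n) \-
        (fun n => (p (tbar + s n *: v) (T y) - p tbar (T y)) / s n)); last first.
      by apply/funext => n /=; rewrite -mulrBl addrK.
    exact: cvgB rem0 (pG _ XT).
  - move=> n; have Tn := b_int _ (sb n).
    rewrite -JE// -JE//; last by move=> y /(fin_dist n)[].
    by case: tbar_min => _ _; apply; exact: interior_subset.
move=> g [c gE].
(* The coefficients of the tangent vector [g] are the direction of variation, so [g] is the
   derivative of the family along [v] on [X]. *)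
pose v : 'rV[R]_M := \row_m c m.
have gG x : X x -> g x = G v x.
  by move=> Xx; rewrite gE//; apply: eq_bigr => m _; rewrite [v 0 m]mxE mulrC.
have [iG iH ge0] := variation v.
have [_ _ le0] := variation (- v).
rewrite intX intT.
have -> : (\int[mu]_(x in D1) (g x)%:E = \int[mu]_(x in D1) (G v x)%:E)%E.
  by apply: eq_integral => x; rewrite inE => /D1X Xx; rewrite gG.
have -> : (\int[nu]_(y in D2) (g (transport X f tbar y))%:E =
           \int[nu]_(y in D2) (G v (T y))%:E)%E.
  by apply: eq_integral => y; rewrite inE => /D2T[_ XTy]; rewrite gG.
have iGT : nu.-integrable D2 (EFin \o (G v \o T)).
  have := integrableN iH; apply: eq_integrable => // y _ /=.
  by rewrite opprK.
rewrite -[LHS]fineK ?(integrable_fin_num mD1 iG)//.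
rewrite -[RHS]fineK ?(integrable_fin_num mD2 iGT)//; congr (_%:E).
rewrite -/(Rintegral mu D1 (G v)) -/(Rintegral nu D2 (G v \o T)).
have NG : \int[mu]_(x in D1) G (- v) x = - \int[mu]_(x in D1) G v x.
  rewrite -mulN1r -RintegralZl//; apply: eq_Rintegral => x _.
  by rewrite /G innerNr mulN1r.
have NGT : \int[nu]_(y in D2) - G v (T y) = - \int[nu]_(y in D2) (G v \o T) y.
  rewrite -mulN1r -RintegralZl//; apply: eq_Rintegral => x _.
  by rewrite mulN1r.
have NNGT : \int[nu]_(y in D2) - G (- v) (T y) = \int[nu]_(y in D2) (G v \o T) y.
  by apply: eq_Rintegral => x _; rewrite /G innerNr opprK.
(* Since [G] is linear in [v], the variations along [v] and [- v] give the two opposite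
   inequalities. *)
rewrite NGT in ge0; rewrite NG NNGT in le0.
by apply/eqP; rewrite eq_le; apply/andP; split; lra.
Qed.
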